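(* Let $d\geq 10^8$ be an integer and let $G=(V,E)$ be a finite simple $d$-regular graph. Then $G$ admits a vertex-colouring edge $3$-weighting, i.e. there exists $\omega:E\to\{1,2,3\}$ such that $\sigma_\omega(u)\neq\sigma_\omega(v)$ for every edge $uv\in E$, where $\sigma_\omega(v):=\sum_{u\in N(v)}\omega(uv)$.
   Context: For a graph $G=(V,E)$, an edge $k$-weighting is a map $\omega:E\to\{1,2,\ldots,k\}$; the weighted degree (sum) of a vertex $v$ is $\sigma_\omega(v)=\sum_{u\in N(v)}\omega(uv)$, where $N(v)$ is the set of neighbours of $v$. The weighting is vertex-colouring if adjacent vertices have distinct sums. *)

(* Defs.v *)
From mathcomp Require Import all_boot.

Set Implicit Arguments.
Unset Strict Implicit.
Unset Printing Implicit Defensive.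

(* A finite simple graph on V is a symmetric irreflexive relation e : rel V;  *)
(* an edge uv is the unordered pair [set u; v].                               *)

Definition neighbours (V : finType) (e : rel V) (v : V) : {set V} :=
  [set u | e v u].

Definition edges (V : finType) (e : rel V) : {set {set V}} :=
  [set [set p.1; p.2] | p in [set p : V * V | e p.1 p.2]].

Definition regular (V : finType) (e : rel V) (d : nat) : Prop :=
  forall v : V, #|neighbours e v| = d.

(* w is a total function on {set V}; only its values on edges are relevant.   *)
Definition edge_weighting (V : finType) (e : rel V) (k : nat)
    (w : {set V} -> nat) : Prop :=
  forall f : {set V}, f \in edges e -> 1 <= w f <= k.

Definition wsum (V : finType) (e : rel V) (w : {set V} -> nat) (v : V) : nat :=
  \sum_(u in neighbours e v) w [set u; v].

Definition vertex_colouring (V : finType) (e : rel V)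
    (w : {set V} -> nat) : Prop :=
  forall u v : V, e u v -> wsum e w u <> wsum e w v.

(* Main.v *)
Require Import Defs.
From mathcomp Require Import all_boot all_order all_algebra zify.

Set Implicit Arguments.
Unset Strict Implicit.
Unset Printing Implicit Defensive.

Import Order.TTheory GRing.Theory Num.Theory.

(** Subtract 2 from all weights, so that edges carry offsets -1, 0, 1; as G is
    regular, all sums drop by the same constant.  We may assume that G is
    connected.  Choose an independent set R, as large as possible such that the
    bipartite graph H of the edges between R and its complement B links R
    together; then R dominates and H is connected.
    We make the vertices of R even and those of B odd, by giving odd offsets to
    a subgraph J of H with odd degree on B and even degree on R.  Take a maximum
    cut of G[B] and let the edges of J be +1 at one side and -1 at the other.
    Maximality of the cut says precisely that any unit flow on the non-cut edges
    of G[B] can be rerouted through the cut edges; hence, processing the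
    vertices in some order, each of the k edges from v to earlier vertices on
    its side may move v by two away from 0 without moving the other end.  So v
    has k + 1 possible values and avoids its k earlier neighbours, while the two
    sides are separated by their signs.
    J exists when |B| is even.  If |B| is odd, a suitable vertex b of B whose
    removal leaves H connected is made even as well, and it remains to separate
    b from its neighbours in R.  If there are at least two of them, this is done
    by the choice of the signs on the edges from b to R.  If there is only one,
    r, then J is modified along a cycle through r; the maximality of R is used
    to find such a cycle when r has many neighbours of this kind. *)

(** * Integral flows *)

Section RowSum.
Local Open Scope ring_scope.
Variable V : finType.
Implicit Types (a b phi : V -> V -> int) (X : {set V}).

Definition row_sum a (v : V) : int := \sum_u a v u.

Definition cut_sum a X : int := \sum_(v in X) \sum_(u in ~: X) a v u.

Definition skew_symmetric phi := forall u v, phi u v = - phi v u.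

Lemma natr_card (R : pzSemiRingType) X : #|X|%:R = \sum_u (u \in X)%:R :> R.
Proof.
rewrite -sum1_card natr_sum big_mkcond; apply: eq_bigr => u _.
by case: (u \in X).
Qed.

Lemma row_sumD a b v :
  row_sum (fun x y => a x y + b x y) v = row_sum a v + row_sum b v.
Proof. exact: big_split. Qed.

Lemma ler_cut_sum a b X :
  (forall u v, a u v <= b u v) -> cut_sum a X <= cut_sum b X.
Proof. by move=> ab; apply: ler_sum => v _; apply: ler_sum. Qed.

Lemma skew_sum0 phi (P : pred V) :
  skew_symmetric phi -> \sum_(v | P v) \sum_(u | P u) phi v u = 0.
Proof.
move=> phiN; set S := LHS.
suff : S = - S by lia.
rewrite /S {1}exchange_big /= -sumrN; apply: eq_bigr => v _.
by rewrite -sumrN; apply: eq_bigr => u _; rewrite phiN.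
Qed.

Lemma sum_row_sum_skew phi X :
  skew_symmetric phi -> \sum_(v in X) row_sum phi v = cut_sum phi X.
Proof.
move=> phiN; under eq_bigr => v _ do rewrite /row_sum (bigID (mem X)) /=.
rewrite big_split /= skew_sum0 // add0r.
by apply: eq_bigr => v _; apply: eq_bigl => u; rewrite inE.
Qed.

End RowSum.

Section Flow.
Local Open Scope ring_scope.
Variables (V : finType) (capacity : V -> V -> int).
Implicit Types (phi psi : V -> V -> int) (b : V -> int) (X : {set V}).

Definition flow phi :=
  skew_symmetric phi /\ forall u v, phi u v <= capacity u v.

Definition residual phi : rel V := fun u v => phi u v < capacity u v.

Definition unit_along (u v x y : V) : int :=
  ((x == u) && (y == v))%:R - ((x == v) && (y == u))%:R.

Lemma row_sum_unit_along u v x :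
  row_sum (unit_along u v) x = (x == u)%:R - (x == v)%:R.
Proof.
have sum_pred1 (w z : V) :
    \sum_y ((x == w) && (y == z))%:R = (x == w)%:R :> int.
  rewrite (bigD1 z) //= eqxx andbT big1 ?addr0 // => y /negbTE->.
  by rewrite andbF.
by rewrite /row_sum sumrB !sum_pred1.
Qed.

Lemma flow_push_edge phi u v : flow phi -> residual phi u v -> u != v ->
  flow (fun x y => phi x y + unit_along u v x y).
Proof.
case=> phiN phi_cap uv_res uv; split=> x y.
  by rewrite /unit_along phiN andbC [(y == v) && _]andbC; lia.
rewrite /unit_along; have := phi_cap x y.
have [->|_] := eqVneq x u; last by lia.
move: uv_res; rewrite /residual.
by have [->|_] /= := eqVneq y v; rewrite ?(negbTE uv) /=; lia.
Qed.

Lemma flow_push_path phi u p :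
  flow phi -> path (residual phi) u p -> uniq (u :: p) ->
  exists2 psi, flow psi &
    forall x, row_sum psi x = row_sum phi x + (x == u)%:R - (x == last u p)%:R.
Proof.
elim: p u phi => [|v p IHp] u phi phi_flow /=.
  by exists phi => // x; rewrite addrK.
case/andP=> uv_res vp /andP[u_vp vp_uniq].
have uv : u != v by move: u_vp; rewrite inE negb_or => /andP[].
pose phi_uv x y := phi x y + unit_along u v x y.
have v_path : path (residual phi_uv) v p.
  apply: (sub_in_path (P := predC1 u)) vp; last first.
    by apply/allP => x; apply: contraTneq => ->.
  move=> x y /negbTE xu /negbTE yu.
  by rewrite /residual /phi_uv /unit_along xu yu andbF subrr addr0.
have [psi psi_flow psiE] :=
  IHp v phi_uv (flow_push_edge phi_flow uv_res uv) v_path vp_uniq.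
by exists psi => // x; rewrite psiE row_sumD row_sum_unit_along; lia.
Qed.

Definition defect b phi : nat := (\sum_v `|b v - row_sum phi v|)%N.

Lemma flow_augment b phi u w : flow phi -> connect (residual phi) u w ->
  row_sum phi u < b u -> b w < row_sum phi w ->
  exists2 psi, flow psi & (defect b psi < defect b phi)%N.
Proof.
move=> phi_flow /connectP[p0 /shortenP[p up up_uniq _] wE] u_low w_high.
have [psi psi_flow] := flow_push_path phi_flow up up_uniq; rewrite -wE => psiE.
have uw : u != w by apply: contraTneq u_low => ->; rewrite -leNgt ltW.
exists psi => //.
rewrite /defect (bigD1 u) //= [X in (_ < X)%N](bigD1 u) //= -addSn leq_add //.
  by rewrite psiE eqxx (negbTE uw); lia.
apply: leq_sum => v vu; rewrite psiE (negbTE vu) /=.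
by have [->|_] := eqVneq v w; lia.
Qed.

Lemma cut_sum_residual_closed phi X :
  (forall u v, u \in X -> residual phi u v -> v \in X) ->
  cut_sum capacity X <= cut_sum phi X.
Proof.
move=> X_closed; apply: ler_sum => v vX; apply: ler_sum => u; rewrite inE.
by move=> uX; rewrite leNgt; apply: contra uX; apply: X_closed.
Qed.

(* Gale's supply-demand theorem *)
Lemma flow_with_row_sums b :
  (forall u v, 0 <= capacity u v) -> \sum_v b v = 0 ->
  (forall X, \sum_(v in X) b v <= cut_sum capacity X) ->
  exists2 phi, flow phi & row_sum phi =1 b.
Proof.
move=> cap_ge0 b_total b_cut.
suff improve n phi : flow phi -> (defect b phi <= n)%N ->
    exists2 phi, flow phi & row_sum phi =1 b.
  by apply: (improve _ (fun _ _ => 0) _ (leqnn _)); split=> // u v;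
    rewrite oppr0.
elim: n phi => [|n IHn] phi phi_flow defect_n.
  exists phi => // v; move: defect_n; rewrite leqn0 sum_nat_eq0.
  by move=> /forallP/(_ v)/=; lia.
have excess_total : \sum_v (b v - row_sum phi v) = 0.
  by rewrite sumrB b_total skew_sum0 ?subr0 //; case: phi_flow.
have [/forallP b_le|/forallPn[u]] := boolP [forall v, b v <= row_sum phi v].
  exists phi => // v; apply/eqP; rewrite eq_sym -subr_eq0 -oppr_eq0.
  have : \sum_w - (b w - row_sum phi w) == 0.
    by rewrite sumrN excess_total oppr0.
  rewrite psumr_eq0 => [/allP/(_ v (mem_index_enum v))|w _];
    first by rewrite implyTb.
  by rewrite opprB subr_ge0.
rewrite -ltNge => u_low; pose X := [set v | connect (residual phi) u v].
have [/exists_inP[w wX w_high]|no_high] :=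
  boolP [exists w in X, b w < row_sum phi w].
  rewrite inE in wX.
  have [psi psi_flow psi_lt] := flow_augment phi_flow wX u_low w_high.
  by apply: (IHn psi psi_flow); rewrite -ltnS (leq_trans psi_lt).
have : 0 < \sum_(v in X) (b v - row_sum phi v).
  rewrite (bigD1 u) ?inE ?connect0 //= ltr_pwDl ?subr_gt0 // sumr_ge0 //.
  move=> v /andP[vX _].
  rewrite subr_ge0 leNgt; apply: contra no_high => v_high; apply/exists_inP.
  by exists v.
rewrite sumrB sum_row_sum_skew; last by case: phi_flow.
rewrite subr_gt0 ltNge (le_trans (b_cut X)) //.
apply: cut_sum_residual_closed => v w.
by rewrite !inE => uv /connect1; apply: connect_trans.
Qed.

End Flow.

(** * Offsets and parities *)

Section Offsets.
Variable V : finType.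
Implicit Types (e i j s : rel V) (a b : V -> V -> int).

Definition odd_degree j v := odd #|neighbours j v|.

Lemma odd_degreeE j v : odd_degree j v = \big[addb/false]_u j v u.
Proof.
rewrite /odd_degree -sum1_card big_mkcond /=.
rewrite (big_morph odd oddD (erefl : odd 0 = false)).
by apply: eq_bigr => u _; rewrite inE; case: (j v u).
Qed.

Lemma eq_odd_degree i j v : i v =1 j v -> odd_degree i v = odd_degree j v.
Proof. by move=> ij; congr odd; apply: eq_card => u; rewrite !inE ij. Qed.

Local Open Scope ring_scope.

Definition offset_weighting e a :=
  [/\ forall u v, a u v = a v u, forall u v, ~~ e u v -> a u v = 0 &
      forall u v, `|a u v| <= 1].

Definition colourable e :=
  exists2 a, offset_weighting e a &
    forall u v, e u v -> row_sum a u <> row_sum a v.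

Lemma offset_weightingS i j a :
  subrel i j -> offset_weighting i a -> offset_weighting j a.
Proof.
move=> ij [a_sym a0 a1]; split=> // u v njuv.
by apply: a0; apply: contra njuv; apply: ij.
Qed.

Lemma offset_weightingD e i j a b : subrel i e -> subrel j e ->
  (forall u v, i u v -> ~~ j u v) ->
  offset_weighting i a -> offset_weighting j b ->
  offset_weighting e (fun u v => a u v + b u v).
Proof.
move=> ie je ij [a_sym a0 a1] [b_sym b0 b1]; split=> u v.
- by rewrite a_sym b_sym.
- by move=> neuv; rewrite a0 ?b0 ?addr0 //; apply: contra neuv;
    [apply: je | apply: ie].
have [/ij/b0->|/a0->] := boolP (i u v); first by rewrite addr0.
by rewrite add0r.
Qed.

Lemma row_sum_isolated e a v :
  offset_weighting e a -> (forall u, ~~ e v u) -> row_sum a v = 0.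
Proof.
by case=> _ a0 _ v_isolated; rewrite /row_sum big1 // => u _; apply: a0.
Qed.

Definition nonzero_rel a : rel V := fun u v => a u v != 0.

Lemma odd_row_sum a v : (forall u, `|a v u| <= 1) ->
  odd `|row_sum a v|%N = odd_degree (nonzero_rel a) v.
Proof.
move=> a1; rewrite odd_degreeE.
apply: (big_ind2 (fun y c => odd `|y|%N = c)) => // [x b y c <- <-|u _];
  first by lia.
by have := a1 u; rewrite /nonzero_rel; case: eqP => [->//|]; lia.
Qed.

Definition signed j s (u v : V) : int := if j u v then (-1) ^+ s u v else 0.

Lemma signed_offset j s : symmetric j -> (forall u v, j u v -> s u v = s v u) ->
  offset_weighting j (signed j s).
Proof.
rewrite /signed => j_sym s_sym; split=> u v;
  last by case: ifP => _; rewrite ?normr_sign ?normr0.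
  by rewrite j_sym; case: ifP => // jvu; rewrite s_sym // j_sym.
by move/negbTE->.
Qed.

Lemma nonzero_rel_signed j s : nonzero_rel (signed j s) =2 j.
Proof.
by move=> u v; rewrite /nonzero_rel /signed; case: ifP => _;
  rewrite ?signr_eq0 ?eqxx.
Qed.

Lemma odd_row_sum_signed j s v :
  odd `|row_sum (signed j s) v|%N = odd_degree j v.
Proof.
rewrite odd_row_sum => [|u];
  last by rewrite /signed; case: ifP => _; rewrite ?normr_sign ?normr0.
by apply: eq_odd_degree => u; rewrite nonzero_rel_signed.
Qed.

Lemma row_sum_signed j s v :
  row_sum (signed j s) v = \sum_(u in neighbours j v) (-1) ^+ s v u.
Proof. by rewrite [RHS]big_mkcond; apply: eq_bigr => u _; rewrite inE. Qed.

Lemma row_sum_signed_const j s v c : (forall u, j v u -> s v u = c) ->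
  row_sum (signed j s) v = (-1) ^+ c * #|neighbours j v|%:R.
Proof.
move=> s_c; rewrite row_sum_signed mulr_natr -sumr_const.
by apply: eq_bigr => u; rewrite inE => /s_c->.
Qed.

End Offsets.

(** * Colouring the two sides of a maximum cut *)

Section MaximumCut.
Local Open Scope ring_scope.
Variables (V : finType) (g : rel V).
Hypothesis g_sym : symmetric g.
Implicit Types (s : V -> bool) (X : {set V}).

Definition cut_edges s : rel V := fun v u => g v u && (s v != s u).

Definition side_edges s : rel V := fun v u => g v u && (s v == s u).

Definition indicator (r : rel V) (v u : V) : int := (r v u)%:R.

Definition maximum_cut s :=
  forall X, cut_sum (indicator (side_edges s)) X <=
    cut_sum (indicator (cut_edges s)) X.

Lemma sum_pairs_cut (w : V -> V -> int) X : (forall u v, w u v = w v u) ->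
  \sum_v \sum_u w v u =
  \sum_v \sum_(u | (v \in X) == (u \in X)) w v u + cut_sum w X *+ 2.
Proof.
move=> w_sym.
under eq_bigr => v _ do rewrite (bigID (fun u => (v \in X) == (u \in X))) /=.
rewrite big_split /=; congr (_ + _); rewrite (bigID (mem X)) /= mulr2n.
congr (_ + _).
  apply: eq_bigr => v vX; apply: eq_bigl => u; rewrite vX inE.
  by case: (u \in X).
rewrite [RHS]exchange_big /=; apply: eq_big => [v|v vX]; first by rewrite inE.
by apply: eq_big => // u; rewrite (negbTE vX); case: (u \in X).
Qed.

Lemma cut_edges_sym s : symmetric (cut_edges s).
Proof. by move=> u v; rewrite /cut_edges g_sym eq_sym. Qed.

Lemma exists_maximum_cut : exists s, maximum_cut s.
Proof.
pose cut_size (s : {ffun V -> bool}) :=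
  \sum_v \sum_u indicator (cut_edges s) v u.
have [s _ s_max] := arg_maxP cut_size (erefl : xpredT [ffun _ : V => true]).
exists s => X; pose t := [ffun v => s v (+) (v \in X)].
have indicator_sym (r : {ffun V -> bool}) u v :
    indicator (cut_edges r) u v = indicator (cut_edges r) v u.
  by rewrite /indicator cut_edges_sym.
have : cut_size t <= cut_size s := s_max t isT.
rewrite /cut_size !(sum_pairs_cut X (indicator_sym _)).
have -> : \sum_v \sum_(u | (v \in X) == (u \in X)) indicator (cut_edges t) v u =
          \sum_v \sum_(u | (v \in X) == (u \in X)) indicator (cut_edges s) v u.
  apply: eq_bigr => v _; apply: eq_bigr => u /eqP vu.
  by rewrite /indicator /cut_edges !ffunE vu; case: (s v); case: (s u);
    case: (u \in X).
suff -> :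
    cut_sum (indicator (cut_edges t)) X =
    cut_sum (indicator (side_edges s)) X.
  by rewrite lerD2l lerMn2r.
apply: eq_bigr => v vX; apply: eq_bigr => u; rewrite inE => /negbTE uX.
by rewrite /indicator /cut_edges /side_edges !ffunE vX uX; case: (s v);
  case: (s u).
Qed.

Lemma flow_offset s phi : flow (indicator (cut_edges s)) phi ->
  offset_weighting (cut_edges s) (fun v u => (-1) ^+ s v * phi v u).
Proof.
case=> phiN phi_cap; have phi0 u v : ~~ cut_edges s u v -> phi u v = 0.
  move/negbTE=> uv; have := phi_cap u v; have := phi_cap v u.
  by rewrite /indicator cut_edges_sym phiN uv; lia.
split=> u v; last 2 first.
- by move=> uv; rewrite phi0 ?mulr0.
- rewrite normrM normr_sign mul1r; have := phi_cap u v; have := phi_cap v u.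
  by rewrite /indicator phiN; lia.
have [/andP[_]|uv] := boolP (cut_edges s u v);
  last by rewrite !phi0 ?mulr0 // cut_edges_sym.
by rewrite phiN; case: (s u); case: (s v); rewrite // ?expr0 ?expr1; lia.
Qed.

(* The edge from [v] to an element of [out v] gets the offset [(-1) ^+ s v],
   which moves both ends; a unit of flow through the cut edges cancels the
   effect at the other end and doubles it at [v]. *)
Lemma cut_weighting s (out : V -> {set V}) : maximum_cut s ->
  (forall v u, u \in out v -> side_edges s v u) ->
  (forall v u, u \in out v -> v \notin out u) ->
  exists2 a, offset_weighting g a &
    forall v, row_sum a v = (-1) ^+ s v * #|out v|.*2%:R.
Proof.
move=> s_max out_side out_asym.
pose net v u : int := (u \in out v)%:R - (v \in out u)%:R.
have net_skew : skew_symmetric net by move=> v u; rewrite /net opprB.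
have net_side v u : net v u <= indicator (side_edges s) v u.
  rewrite /net /indicator; have [/out_side->|_] := boolP (u \in out v).
    by case: (v \in out u).
  by case: (v \in out u); case: side_edges.
have [|||phi phi_flow phi_row] :=
  @flow_with_row_sums V (indicator (cut_edges s)) (row_sum net).
- by [].
- exact: skew_sum0.
- by move=> X; rewrite sum_row_sum_skew // (le_trans (ler_cut_sum X net_side)).
pose used : rel V := fun v u => (u \in out v) || (v \in out u).
have used_side v u : used v u -> side_edges s v u.
  by case/orP=> /out_side; rewrite /side_edges // g_sym eq_sym.
exists (fun v u => signed used (fun v _ => s v) v u + (-1) ^+ s v * phi v u).
  apply: (@offset_weightingD _ _ used (cut_edges s)) (flow_offset phi_flow).
  - by move=> v u /used_side/andP[].
  - by move=> v u /andP[].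
  - by move=> v u /used_side/andP[_ /eqP sE]; rewrite /cut_edges sE eqxx andbF.
  apply: signed_offset => [v u|v u /used_side/andP[_ /eqP //]].
  by rewrite /used orbC.
move=> v; rewrite row_sumD (row_sum_signed_const (c := s v)) //.
have -> : #|neighbours used v|%:R =
    \sum_u ((u \in out v)%:R + (v \in out u)%:R) :> int.
  rewrite natr_card; apply: eq_bigr => u _; rewrite inE /used.
  by have [/out_asym/negbTE->|_] := boolP (u \in out v); case: (v \in out u).
rewrite /row_sum -mulr_sumr -mulrDr [X in _ + X]phi_row /net -big_split /=.
congr (_ * _).
rewrite -muln2 natrM natr_card mulr_suml; apply: eq_bigr => u _.
by rewrite addrACA subrr addr0 mulr_natr.
Qed.

End MaximumCut.

Section Greedy.
Variables (V : finType) (T : eqType).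
Implicit Types (A : {set V}) (f : V -> nat -> T).

Lemma exists_avoiding A (taken : V -> T) (colour : nat -> T) :
  injective colour ->
  exists2 k, k <= #|A| & forall u, u \in A -> taken u <> colour k.
Proof.
move=> colour_inj.
have [/allP all_taken|/allPn[c /mapP[k]]] :=
    boolP (all (mem [seq taken u | u in A]) (map colour (iota 0 #|A|.+1))).
  have := uniq_leq_size _ all_taken.
  rewrite map_inj_uniq // iota_uniq size_map size_iota.
  by rewrite size_image ltnn => /(_ isT).
rewrite mem_iota ltnS => kA -> k_free; exists k => // u uA taken_u.
by case/negP: k_free; rewrite -taken_u; apply: image_f.
Qed.

Lemma greedy_choice (rank : V -> nat) (earlier : V -> {set V}) f :
  (forall v u, u \in earlier v -> rank u < rank v) ->
  (forall v, injective (f v)) ->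
  exists2 m : V -> nat, forall v, m v <= #|earlier v| &
    forall v u, u \in earlier v -> f u (m u) <> f v (m v).
Proof.
move=> earlier_rank f_inj.
suff chosen n : exists2 m : V -> nat, forall v, m v <= #|earlier v| &
    forall v u, rank v < n -> u \in earlier v -> f u (m u) <> f v (m v).
  have [m m_le m_ok] := chosen (\max_v rank v).+1; exists m => // v u.
  by apply: m_ok; rewrite ltnS leq_bigmax.
elim: n => [|n [m m_le m_ok]]; first by exists (fun=> 0).
have /fin_all_exists2[k k_le k_ok] v :=
  exists_avoiding (earlier v) (fun u => f u (m u)) (f_inj v).
exists (fun v => if rank v == n then k v else m v) => [v|v u];
  first by case: ifP.
rewrite ltnS => vn uv; have := earlier_rank v u uv.
have [vnE|vn_neq] := eqVneq (rank v) n;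
  first by rewrite vnE => /ltn_eqF->; apply: k_ok.
by move=> /leq_trans/(_ vn)/ltn_eqF->; apply: m_ok;
  rewrite // ltn_neqAle vn_neq.
Qed.

End Greedy.

Lemma exists_between_card (V : finType) (A B : {set V}) k :
  A \subset B -> #|A| <= k <= #|B| ->
  exists M : {set V}, [/\ A \subset M, M \subset B & #|M| = k].
Proof.
move=> AB /andP[Ak kB].
have /card_geqP[m [m_uniq m_size mBA]] : k - #|A| <= #|B :\: A|.
  by rewrite cardsD (setIidPr AB) leq_sub2r.
exists (A :|: [set x in m]); split; first exact: subsetUl.
  rewrite subUset AB; apply/subsetP => x; rewrite inE => /mBA.
  by rewrite inE => /andP[].
rewrite cardsU disjoint_setI0 ?cards0 ?subn0.
  by rewrite cardsE (card_uniqP m_uniq) m_size subnKC.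
rewrite disjoint_sym disjoints_subset; apply/subsetP => x; rewrite !inE => /mBA.
by rewrite inE => /andP[].
Qed.

Lemma pigeonhole (T F : finType) (f : T -> F) (A : {set T}) : #|F| < #|A| ->
  exists x y, [/\ x \in A, y \in A, x != y & f x = f y].
Proof.
move=> FA.
have /dinjectivePn[x xA [y /andP[yx yA] fxy]] : ~~ dinjectiveb f (mem A).
  apply: contraL FA => /dinjectiveP f_inj; rewrite -leqNgt.
  exact: leq_card_in f_inj.
by exists x, y; rewrite eq_sym yx.
Qed.

Lemma two_sided_colouring (V : finType) (g : rel V) :
  symmetric g -> irreflexive g ->
  exists s : V -> bool, forall base : V -> nat, exists a (m : V -> nat),
    [/\ offset_weighting g a,
        forall v, (row_sum a v = (-1) ^+ s v * (m v).*2%:R)%R &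
        forall u v, g u v -> s u = s v ->
          base u + (m u).*2 <> base v + (m v).*2].
Proof.
move=> g_sym g_irr; have [s s_max] := exists_maximum_cut g_sym.
exists s => base.
pose earlier v := [set u | side_edges g s v u & enum_rank u < enum_rank v].
have [||m m_le m_ok] :=
  greedy_choice (rank := fun v => enum_rank v) (earlier := earlier)
    (f := fun v k => base v + k.*2).
- by move=> v u; rewrite inE => /andP[].
- by move=> v k l; lia.
have /fin_all_exists2[out out_earlier out_card] v :
    exists2 out : {set V}, out \subset earlier v & #|out| = m v.
  have [|out [_ ? ?]] := exists_between_card (k := m v) (sub0set (earlier v));
    last by exists out.
  by rewrite cards0 m_le.
have outP v u : u \in out v ->
    side_edges g s v u && (enum_rank u < enum_rank v).
  by move/(subsetP (out_earlier v)); rewrite inE.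
have [||a a_offset a_sum] := cut_weighting g_sym (out := out) s_max.
- by move=> v u /outP/andP[].
- by move=> v u /outP/andP[_ uv]; apply/negP => /outP/andP[_]; lia.
exists a, m; split=> // [v|u v guv suv]; first by rewrite a_sum out_card.
have : enum_rank u != enum_rank v.
  by rewrite (inj_eq enum_rank_inj); apply: contraTneq guv => ->; rewrite g_irr.
rewrite neq_ltn => /orP[] lt;
  first by apply: m_ok; rewrite inE /side_edges g_sym guv suv eqxx.
by move/esym; apply: m_ok; rewrite inE /side_edges guv suv eqxx.
Qed.

(** * Parity joins *)

Section ParityJoins.
Variable V : finType.
Implicit Types (i j H : rel V) (D A : {set V}) (S T : pred V).

Definition xor_rel i j : rel V := fun u v => i u v (+) j u v.

Definition star x A : rel V :=
  fun u v => ((u == x) && (v \in A)) || ((v == x) && (u \in A)).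

Definition parity_join H T j :=
  [/\ symmetric j, subrel j H & odd_degree j =1 T].

Lemma star_sym x A : symmetric (star x A).
Proof. by move=> u v; rewrite /star orbC. Qed.

Lemma neighbours_star x A u : x \notin A ->
  neighbours (star x A) u =
    if u == x then A else if u \in A then [set x] else set0.
Proof.
move=> xA; apply/setP => v; rewrite inE /star.
have [->|ux] := eqVneq u x; first by rewrite (negbTE xA) andbF orbF.
by case: (u \in A); rewrite !inE ?andbT ?andbF.
Qed.

Lemma odd_degree_xor i j v :
  odd_degree (xor_rel i j) v = odd_degree i v (+) odd_degree j v.
Proof. by rewrite !odd_degreeE; apply: big_split. Qed.

Lemma odd_degree_star x A u : x \notin A ->
  odd_degree (star x A) u = if u == x then odd #|A| else u \in A.
Proof.
by move=> xA; rewrite /odd_degree neighbours_star //; do 2?case: ifP => _;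
  rewrite ?cards1 ?cards0.
Qed.

Lemma eq_parity_join H S T j : S =1 T -> parity_join H S j -> parity_join H T j.
Proof. by move=> ST [j_sym jH jS]; split=> // v; rewrite jS ST. Qed.

Lemma parity_join_sub H H' T j :
  subrel H H' -> parity_join H T j -> parity_join H' T j.
Proof. by move=> HH' [j_sym jH jT]; split=> // u v /jH/HH'. Qed.

Lemma empty_join H : parity_join H xpred0 (fun _ _ => false).
Proof. by split=> // v; rewrite odd_degreeE big1. Qed.

Lemma xor_join H S T i j : parity_join H S i -> parity_join H T j ->
  parity_join H (fun v => S v (+) T v) (xor_rel i j).
Proof.
move=> [i_sym iH iS] [j_sym jH jT]; split=> [u v|u v|v].
- by rewrite /xor_rel i_sym j_sym.
- by rewrite /xor_rel; have [/iH//|_] := boolP (i u v); rewrite addFb => /jH.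
by rewrite odd_degree_xor iS jT.
Qed.

Lemma star_join H x A :
  symmetric H -> x \notin A -> (forall y, y \in A -> H x y) ->
  parity_join H (fun u => if u == x then odd #|A| else u \in A) (star x A).
Proof.
move=> H_sym xA xH; split=> [|u v|u];
  [exact: star_sym| |exact: odd_degree_star].
by case/orP=> /andP[/eqP-> /xH //]; rewrite H_sym.
Qed.

Lemma path_join H x y : symmetric H -> irreflexive H -> connect H x y ->
  exists j, parity_join H (fun v => (v == x) (+) (v == y)) j.
Proof.
move=> H_sym H_irr /connectP[p]; elim: p x => [|z p IHp] x /=.
  move=> _ ->; exists (fun _ _ => false).
  apply: eq_parity_join (empty_join H) => v.
  by rewrite addbb.
case/andP=> xz zp yE; have [j jP] := IHp z zp yE.
have zx : z != x by apply: contraTneq xz => ->; rewrite H_irr.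
have x_notin : x \notin [set z] by rewrite inE eq_sym.
have x_adj w : w \in [set z] -> H x w by rewrite inE => /eqP->.
exists (xor_rel (star x [set z]) j).
apply: eq_parity_join (xor_join (star_join H_sym x_notin x_adj) jP) => v.
rewrite cards1 inE.
have [->|_] := eqVneq v x; first by rewrite [x == z]eq_sym (negbTE zx).
by rewrite addbA addbb.
Qed.

Lemma connected_join H D A : symmetric H -> irreflexive H ->
  {in D &, forall x y, connect H x y} -> A \subset D -> ~~ odd #|A| ->
  exists j, parity_join H (mem A) j.
Proof.
move=> H_sym H_irr D_conn; have [n] := ubnP #|A|.
elim: n A => // n IHn A An AD A_even.
have [A0|[x xA]] := set_0Vmem A.
  exists (fun _ _ => false); apply: eq_parity_join (empty_join H) => v.
  by rewrite /= A0 inE.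
have [Ax0|[y yAx]] := set_0Vmem (A :\ x).
  by move: A_even; rewrite (cardsD1 x) xA Ax0 cards0.
have yA : y \in A := subsetP (subD1set A x) y yAx.
have A_card : #|A| = (#|A :\ x :\ y|).+2.
  by rewrite (cardsD1 x) xA (cardsD1 y (A :\ x)) yAx.
have [|||j jP] := IHn (A :\ x :\ y).
- by rewrite A_card in An; lia.
- by rewrite (subset_trans _ AD) // (subset_trans (subD1set _ _)) ?subD1set.
- by move: A_even; rewrite A_card /= negbK.
have [i iP] :=
  path_join H_sym H_irr (D_conn x y (subsetP AD _ xA) (subsetP AD _ yA)).
exists (xor_rel i j); apply: eq_parity_join (xor_join iP jP) => v.
move: yAx; rewrite /= !inE => /andP[yx _].
have [->|_] := eqVneq v x; first by rewrite xA [x == y]eq_sym (negbTE yx).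
by have [->|_] := eqVneq v y; rewrite ?yA.
Qed.

End ParityJoins.

(** * Choices of signs *)

(* Read [f k] as the number of elements that need a minus sign when [k] minus
   signs are used, so that [f k.-1] of them need a plus sign. *)
Section Balance.
Variables (n : nat) (f : nat -> nat).
Hypothesis f_sum : forall ks, uniq ks -> \sum_(k <- ks) f k <= n.

Definition balanced k := [&& k <= n, f k <= k & (0 < k) ==> (f k.-1 + k <= n)].

Lemma exists_balanced : 1 < n -> exists k, balanced k.
Proof.
move=> n_gt1.
have f_pair i j : i != j -> f i + f j <= n.
  move=> ij; have := f_sum (ks := [:: i; j]).
  by rewrite !big_cons big_nil /= inE ij addn0; apply.
have f_triple i j k : [&& i != j, i != k & j != k] -> f i + f j + f k <= n.
  move=> /and3P[ij ik jk]; have := f_sum (ks := [:: i; j; k]).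
  by rewrite !big_cons big_nil /= !inE negb_or ij ik jk addn0 addnA; apply.
have fn : f n <= n.
  by have := f_sum (ks := [:: n]); rewrite big_cons big_nil addn0; apply.
have ex : exists k, f k <= k by exists n.
case: (ex_minnP ex) => k fk k_min.
have below j : j < k -> j < f j by rewrite !ltnNge; apply: contra; apply: k_min.
have kn : k <= n := k_min n fn.
have [k_ok|] := boolP (balanced k); first by exists k.
rewrite /balanced kn fk /= negb_imply -ltnNge => /andP[k_gt0].
case: k => [|[|[|k]]] // in fk k_min below kn k_gt0 * => /= f_big.
- have := f_pair 0 1 isT; have := f_pair 0 2 isT.
  by exists 2; rewrite /balanced /=; lia.
- have := below 0 isT; have := below 1 isT; have := f_triple 0 1 2 isT.
  by have := f_triple 0 1 3 isT; exists 3; rewrite /balanced /=; lia.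
by have := below k.+1; have := below k; have := f_triple k k.+1 k.+2; lia.
Qed.

Lemma exists_balanced_neq k0 : 40 <= n -> exists2 k, balanced k & k != k0.
Proof.
move=> n_ge40; pose h := n./2 - 4.
have : \sum_(k <- [seq h + i | i <- iota 0 8]) f k <= n.
  by apply: f_sum; rewrite map_inj_uniq ?iota_uniq // => i j; lia.
rewrite big_map /= !big_cons big_nil addn0 => f_window.
suff /hasP[k _ /andP[]] :
    has (fun k => balanced k && (k != k0)) [:: h + 1; h + 3; h + 5; h + 7].
  by exists k.
apply: contraT; move: f_window; rewrite /balanced /= !addnS !addn0 /= /h; lia.
Qed.

End Balance.

Section Signs.
Local Open Scope ring_scope.
Variables (V : finType) (I : {set V}) (c : V -> int) (K : int).

Lemma sum_signs (M : {set V}) : M \subset I ->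
  \sum_(r in I) (-1) ^+ (r \in M) = #|I|%:R - #|M|.*2%:R :> int.
Proof.
move=> MI; under eq_bigr => r _ do rewrite signrE.
rewrite big_split /= sumrN sumr_const; congr (_ - _).
rewrite -sum1_card -muln2 big_distrl /= natr_sum.
rewrite [RHS]big_mkcond [LHS]big_mkcond.
apply: eq_bigr => r _; have [/(subsetP MI)->//|_] := boolP (r \in M).
by case: (r \in I).
Qed.

Definition signed_total (k : nat) : int := K + #|I|%:R - k.*2%:R.

Definition forced_minus (k : nat) : nat :=
  #|[set r in I | c r == signed_total k - 1]|.

Lemma sum_forced_minus (ks : seq nat) :
  uniq ks -> (\sum_(k <- ks) forced_minus k <= #|I|)%N.
Proof.
move=> ks_uniq.
under eq_bigr => k _ do rewrite /forced_minus -sum1dep_card big_mkcondr.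
rewrite exchange_big /= -sum1_card; apply: leq_sum => r rI.
rewrite -big_mkcond /= sum1_count.
have [/hasP[k k_ks /eqP ck]|] :=
  boolP (has (fun k => c r == signed_total k - 1) ks).
  rewrite (eq_count (a2 := pred1 k)) ?count_uniq_mem ?leq_b1 // => l /=.
  by rewrite ck /signed_total; apply/eqP/eqP => [|->//]; lia.
by rewrite has_count -leqNgt leqn0 => /eqP->.
Qed.

Lemma signs_of_balanced k : balanced #|I| forced_minus k ->
  exists M : {set V}, [/\ M \subset I, #|M| = k &
    forall r, r \in I -> c r + (-1) ^+ (r \in M) <> signed_total k].
Proof.
case/and3P=> kI minus_k plus_k.
pose minus := [set r in I | c r == signed_total k - 1].
pose plus := [set r in I | c r == signed_total k + 1].
have [|| M [minusM MI Mk]] := @exists_between_card V minus (I :\: plus) k.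
- by apply/subsetP => r; rewrite !inE => /andP[-> /eqP->]; rewrite andbT; lia.
- apply/andP; split=> //; rewrite cardsD (setIidPr _) ?subsetIl //; last first.
    by apply/subsetP => r; rewrite inE => /andP[].
  have [->|k_gt0] := posnP k; first exact: leq0n.
  suff -> : #|plus| = forced_minus k.-1 by move: plus_k; rewrite k_gt0 /=; lia.
  apply: eq_card => r; rewrite !inE; congr (_ && (_ == _)).
  by rewrite /signed_total; lia.
exists M; split=> // [|r rI]; first exact: subset_trans MI (subsetDl _ _).
have [rM|rM] := boolP (r \in M); rewrite ?expr1 ?expr0.
  by have := subsetP MI r rM; rewrite !inE rI andbT; lia.
by have := contra (subsetP minusM r) rM; rewrite !inE rI; lia.
Qed.

Lemma exists_signs : (1 < #|I|)%N ->
  exists2 M : {set V}, M \subset I &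
    forall r, r \in I -> c r + (-1) ^+ (r \in M) <> K + #|I|%:R - #|M|.*2%:R.
Proof.
move=> I_gt1; have [k k_bal] := exists_balanced sum_forced_minus I_gt1.
have [M [MI Mk M_sep]] := signs_of_balanced k_bal; exists M => // r /M_sep.
by rewrite Mk.
Qed.

Lemma exists_signs_neq (t : int) : (40 <= #|I|)%N ->
  exists M : {set V}, [/\ M \subset I, K + #|I|%:R - #|M|.*2%:R <> t &
    forall r, r \in I -> c r + (-1) ^+ (r \in M) <> K + #|I|%:R - #|M|.*2%:R].
Proof.
move=> I_ge40; pose k0 := (absz (K + #|I|%:R - t)%R)./2.
have [k k_bal k_k0] := exists_balanced_neq sum_forced_minus k0 I_ge40.
have [M [MI Mk M_sep]] := signs_of_balanced k_bal; exists M; rewrite Mk.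
split=> //.
by move=> kE; case/eqP: k_k0; rewrite /k0 -kE; lia.
Qed.

End Signs.

(** * Assembling the offsets *)

Section Subgraphs.
Variables (V : finType) (e : rel V).
Hypotheses (e_sym : symmetric e) (e_irr : irreflexive e).
Implicit Types (R X : {set V}).

Definition induced X : rel V := fun u v => [&& e u v, u \in X & v \in X].

Definition crossing R : rel V := fun u v => e u v && ((u \in R) != (v \in R)).

Definition delete X : rel V := fun u v => [&& e u v, u \notin X & v \notin X].

Lemma induced_sym X : symmetric (induced X).
Proof. by move=> u v; rewrite /induced e_sym [(u \in X) && _]andbC. Qed.

Lemma induced_irr X : irreflexive (induced X).
Proof. by move=> u; rewrite /induced e_irr. Qed.

Lemma crossing_sym R : symmetric (crossing R).
Proof. by move=> u v; rewrite /crossing e_sym eq_sym. Qed.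

Lemma crossing_irr R : irreflexive (crossing R).
Proof. by move=> u; rewrite /crossing e_irr. Qed.

Lemma crossing_in R u v : u \in R -> crossing R u v = e u v && (v \notin R).
Proof. by rewrite /crossing => ->. Qed.

Lemma crossing_notin R u v : u \notin R -> crossing R u v = e u v && (v \in R).
Proof. by rewrite /crossing => /negbTE->; case: (v \in R). Qed.

Lemma delete_sym X : symmetric (delete X).
Proof. by move=> u v; rewrite /delete e_sym [(u \notin X) && _]andbC. Qed.

Lemma delete_irr X : irreflexive (delete X).
Proof. by move=> u; rewrite /delete e_irr. Qed.

Lemma notin_neighbours x X : X \subset neighbours e x -> x \notin X.
Proof. by move=> Xx; apply/negP => /(subsetP Xx); rewrite inE e_irr. Qed.

Definition independent R := [forall u in R, forall v in R, ~~ e u v].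

Lemma independentP R : reflect {in R &, forall u v, ~~ e u v} (independent R).
Proof.
apply: (iffP forall_inP) => [R_ind u v /R_ind/forall_inP|R_ind u uR];
  first exact.
by apply/forall_inP => v; apply: R_ind.
Qed.

End Subgraphs.

Section Assembly.
Local Open Scope ring_scope.
Variables (V : finType) (e : rel V).
Hypotheses (e_sym : symmetric e) (e_irr : irreflexive e).

Definition side_sum (s : V -> bool) (j : rel V) : V -> int :=
  row_sum (signed j (fun _ v => s v)).

Lemma side_sum_xor s i j u :
  side_sum s (xor_rel i j) u =
  side_sum s i u + \sum_(v in neighbours j u) (-1) ^+ (i u v (+) s v).
Proof.
rewrite [X in _ + X]big_mkcond /side_sum /row_sum -big_split.
apply: eq_bigr => v _.
rewrite inE /signed /xor_rel signr_addb.
by case: (i u v); case: (j u v) => /=; rewrite ?expr1 ?expr0; case: (s v);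
  rewrite ?expr1 ?expr0.
Qed.

Lemma side_sum_toggle s i j r y z :
  neighbours i r = [set y; z] -> y != z -> s y = s z -> j r y = j r z ->
  side_sum s (xor_rel j i) r =
  side_sum s j r + (-1) ^+ (j r y (+) s y) *+ 2.
Proof.
move=> r_nbrs yz sE jE; rewrite side_sum_xor r_nbrs big_setU1 ?inE //= big_set1.
by rewrite -sE -jE -mulr2n.
Qed.

Lemma crossing_induced_offset (E : {set V}) s j t :
  parity_join (crossing e E)
    (fun u => (u \notin E) (+) odd_degree (nonzero_rel t) u) j ->
  offset_weighting (induced e E) t ->
  exists a,
    [/\ offset_weighting (fun u v => crossing e E u v || induced e E u v) a,
        forall u, u \in E -> row_sum a u = side_sum s j u + row_sum t u,
        forall u, u \in E -> ~~ odd `|row_sum a u|%N &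
        forall u, u \notin E ->
          odd_degree j u /\ row_sum a u = (-1) ^+ s u * #|neighbours j u|%:R].
Proof.
move=> [j_sym j_cross j_odd] t_offset.
pose b := signed j (fun u v => s (if u \in E then v else u)).
have b_offset : offset_weighting j b.
  by apply: signed_offset => // u v /j_cross/andP[_]; case: (u \in E);
    case: (v \in E).
have sum_in u : u \in E -> row_sum b u = side_sum s j u.
  by move=> uE; apply: eq_bigr => v _; rewrite /b /signed uE.
have t_out u : u \notin E -> forall v, ~~ induced e E u v.
  by move=> /negbTE uE v; rewrite /induced uE andbF.
exists (fun u v => b u v + t u v); split=> [|u uE|u uE|u uE].
- apply: (@offset_weightingD _ _ j (induced e E)) => // u v;
    [by move/j_cross-> | |].
    by move->; rewrite orbT.
  by move/j_cross/andP=> [_]; apply: contra => /and3P[_ -> ->].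
- by rewrite row_sumD sum_in.
- have : odd `|row_sum b u|%N = odd `|row_sum t u|%N.
    by rewrite odd_row_sum_signed j_odd uE odd_row_sum => // v; case: t_offset.
  by rewrite row_sumD; lia.
rewrite row_sumD (row_sum_isolated t_offset (t_out u uE)) addr0 j_odd uE; split.
  rewrite odd_degreeE big1 // => v _; apply: negbTE; rewrite negbK.
  by case: t_offset => _ t0 _; rewrite t0 ?t_out.
by rewrite (row_sum_signed_const (c := s u)) // => v _; rewrite (negbTE uE).
Qed.

(* Vertices outside [E] end up odd, positive on one side of the cut and
   negative on the other, and those of [E] even; so conflicts can only occur
   inside [E]. *)
Lemma assembly (E : {set V}) : exists s : V -> bool, forall j t,
  parity_join (crossing e E)
    (fun u => (u \notin E) (+) odd_degree (nonzero_rel t) u) j ->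
  offset_weighting (induced e E) t ->
  {in E &, forall u v, e u v ->
    side_sum s j u + row_sum t u <> side_sum s j v + row_sum t v} ->
  colourable e.
Proof.
have [s s_colours] :=
  two_sided_colouring (induced_sym e_sym (~: E)) (induced_irr e_irr (~: E)).
exists s => j t j_join t_offset sep.
have [a [a_offset a_in a_even a_out]] :=
  crossing_induced_offset s j_join t_offset.
have [b [m [b_offset b_sum m_sep]]] := s_colours (fun u => #|neighbours j u|).
have sum_in u : u \in E -> row_sum a u + row_sum b u = row_sum a u.
  move=> uE; rewrite (row_sum_isolated b_offset) ?addr0 // => v.
  by rewrite /induced inE uE andbF.
have sum_out u : u \notin E ->
    row_sum a u + row_sum b u =
      (-1) ^+ s u * (#|neighbours j u| + (m u).*2)%N%:R.
  by move=> /a_out[_ ->]; rewrite b_sum natrD mulrDr.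
have sum_odd u : odd (absz (row_sum a u + row_sum b u)%R) = (u \notin E).
  have [uE|uE] := boolP (u \in E);
    first by rewrite sum_in //; apply/negbTE/a_even.
  rewrite sum_out // abszMsign; have [] := a_out u uE.
  by rewrite /odd_degree; lia.
exists (fun u v => a u v + b u v).
  apply: offset_weightingD a_offset b_offset => u v;
    first by case/orP=> [/andP[]|/and3P[]].
    by case/and3P.
  move=> uv; apply/and3P => -[_]; rewrite !inE => uE vE; move: uv.
  by rewrite /crossing /induced (negbTE uE) (negbTE vE) !andbF.
move=> u v euv; rewrite !row_sumD => sumE.
have uvE : (u \in E) = (v \in E) by apply: negb_inj; rewrite -!sum_odd sumE.
have [uE|uE] := boolP (u \in E); have vE := uE; rewrite uvE in vE.
  by have := sep u v uE vE euv; rewrite -!a_in // -sum_in // sumE sum_in.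
have [] := a_out u uE; rewrite /odd_degree; have := m_sep u v.
rewrite /induced !inE euv uE vE => /(_ isT); move: sumE; rewrite !sum_out //.
by case: (s u); case: (s v); rewrite ?expr1 ?expr0; lia.
Qed.

End Assembly.

Section ExceptionalVertex.
Local Open Scope ring_scope.
Variables (V : finType) (e : rel V) (R : {set V}) (x : V).
Hypotheses (e_sym : symmetric e) (e_irr : irreflexive e).
Hypotheses (R_ind : independent e R) (xR : x \notin R).

(* [x] is even like the vertices of [R]; its odd edges go to [Y] and [I], and
   those to [M] carry a minus sign. *)
Definition admissible (Y I : {set V}) (j : rel V) :=
  [/\ Y \subset neighbours e x :\: R, I \subset neighbours e x :&: R,
      ~~ odd (#|Y| + #|I|) &
      parity_join (delete (crossing e R) [set x])
        (fun v => [&& v != x, v \notin R & v \notin Y] || (v \in I)) j].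

Definition separating s (Y I M : {set V}) j :=
  M \subset I /\ forall r, r \in neighbours e x :&: R ->
    side_sum s j r + (if r \in I then (-1) ^+ (r \in M) else 0) <>
    \sum_(y in Y) (-1) ^+ s y + #|I|%:R - #|M|.*2%:R.

Definition separable s :=
  exists Y I M j, admissible Y I j /\ separating s Y I M j.

Lemma admissible_notin (Y I : {set V}) j :
  admissible Y I j -> x \notin Y /\ x \notin I.
Proof.
case=> YP IP _ _; split; apply: (notin_neighbours e_irr).
  exact: subset_trans YP (subsetDl _ _).
exact: subset_trans IP (subsetIl _ _).
Qed.

Lemma admissible_star_join (Y I : {set V}) j : admissible Y I j ->
  parity_join (crossing e (x |: R))
    (fun u => (u \notin x |: R) (+) odd_degree (star x I) u)
    (xor_rel j (star x Y)).
Proof.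
move=> j_adm; have [YP IP YI_even j_join] := j_adm.
have [xY xI] := admissible_notin j_adm.
have star_cross y : y \in Y -> crossing e (x |: R) x y.
  move/(subsetP YP); rewrite !inE /crossing !inE eqxx /= => /andP[yR exy].
  have /negbTE-> : y != x by apply: contraTneq exy => ->; rewrite e_irr.
  by rewrite exy (negbTE yR).
have delete_cross :
    subrel (delete (crossing e R) [set x]) (crossing e (x |: R)).
  move=> u v /and3P[/andP[euv uv]]; rewrite !inE => /negbTE ux /negbTE vx.
  by rewrite /crossing euv !inE ux vx.
have := xor_join (parity_join_sub delete_cross j_join)
  (star_join (crossing_sym e_sym _) xY star_cross).
apply: eq_parity_join => u; rewrite odd_degree_star // !inE.
have [->|ux] := eqVneq u x.
  by rewrite (negbTE xI) /=; move: YI_even; rewrite oddD; case: (odd _);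
    case: (odd _).
have [uR|uR] := boolP (u \in R).
  have /negbTE-> : u \notin Y by apply/negP => /(subsetP YP); rewrite !inE uR.
  by rewrite addbF.
have /negbTE-> : u \notin I.
  by apply/negP => /(subsetP IP); rewrite !inE (negbTE uR) andbF.
by case: (u \in Y).
Qed.

Definition root_offset (I M : {set V}) : V -> V -> int :=
  signed (star x I) (fun u v => (u \in M) || (v \in M)).

Definition exceptional_sum s (Y I M : {set V}) j u : int :=
  side_sum s (xor_rel j (star x Y)) u + row_sum (root_offset I M) u.

Lemma root_offset_induced (I M : {set V}) : I \subset neighbours e x :&: R ->
  offset_weighting (induced e (x |: R)) (root_offset I M).
Proof.
move=> /subsetP IP; apply: (@offset_weightingS _ (star x I)); last first.
  by apply: signed_offset => [|u v _]; [exact: star_sym | rewrite orbC].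
move=> u v; rewrite /induced !inE => /orP[] /andP[/eqP-> /IP].
  by rewrite !inE eqxx => /andP[-> ->]; rewrite orbT.
by rewrite !inE eqxx e_sym => /andP[-> ->]; rewrite orbT.
Qed.

Lemma exceptional_sum_center s (Y I M : {set V}) j :
  admissible Y I j -> M \subset I ->
  exceptional_sum s Y I M j x =
  \sum_(y in Y) (-1) ^+ s y + #|I|%:R - #|M|.*2%:R.
Proof.
move=> j_adm MI; have [_ _ _ [_ j_sub _]] := j_adm.
have [xY xI] := admissible_notin j_adm.
have xM : x \in M = false by apply: contraNF xI; apply: (subsetP MI).
have jx v : j x v = false by apply/negP => /j_sub/and3P[_]; rewrite set11.
rewrite /exceptional_sum side_sum_xor row_sum_signed !neighbours_star // eqxx.
rewrite xM sum_signs // addrA; congr (_ + _ - _).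
rewrite /side_sum row_sum_signed big_pred0 ?add0r => [|v];
  last by rewrite inE jx.
by apply: eq_bigr => y _; rewrite jx.
Qed.

Lemma exceptional_sum_root s (Y I M : {set V}) j u :
  admissible Y I j -> M \subset I -> u \in R ->
  exceptional_sum s Y I M j u =
  side_sum s j u + (if u \in I then (-1) ^+ (u \in M) else 0).
Proof.
move=> j_adm MI uR; have [YP _ _ _] := j_adm.
have [xY xI] := admissible_notin j_adm.
have xM : x \in M = false by apply: contraNF xI; apply: (subsetP MI).
have ux : u != x by apply: contraNneq xR => <-.
have uY : u \notin Y by apply/negP => /(subsetP YP); rewrite !inE uR.
rewrite /exceptional_sum side_sum_xor row_sum_signed !neighbours_star //.
rewrite (negbTE ux) (negbTE uY) big_set0 addr0.
by case: ifP => _; rewrite ?big_set0 // big_set1 xM orbF.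
Qed.

Lemma exceptional_assembly : (forall s, separable s) -> colourable e.
Proof.
have [s s_colours] := assembly e_sym e_irr (x |: R).
move=> /(_ s)[Y [I [M [j [j_adm [MI sep]]]]]].
have sum_neq u : u \in R -> e x u ->
    exceptional_sum s Y I M j u <> exceptional_sum s Y I M j x.
  move=> uR exu; rewrite exceptional_sum_center // exceptional_sum_root //.
  by apply: sep; rewrite !inE exu.
apply: (s_colours (xor_rel j (star x Y)) (root_offset I M)).
- apply: eq_parity_join (admissible_star_join j_adm) => u; congr (_ (+) _).
  by apply: eq_odd_degree => v; rewrite nonzero_rel_signed.
- by apply: root_offset_induced; case: j_adm.
move=> u v; rewrite !inE => /orP[/eqP->|uR] /orP[/eqP->|vR];
  first by rewrite e_irr.
- by move=> exv /esym; apply: sum_neq.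
- by rewrite e_sym; apply: sum_neq.
by have /negbTE-> := independentP _ _ R_ind u v uR vR.
Qed.

End ExceptionalVertex.

(** * Maximum linked sets *)

Section Distance.
Variables (V : finType) (H : rel V) (root : V).
Hypothesis H_sym : symmetric H.

Definition distance_to (dist : V -> nat) :=
  (forall x, x != root -> exists2 z, H x z & dist z < dist x) /\
  (forall x z, H x z -> dist z <= (dist x).+1).

Lemma exists_distance :
  (forall x, connect H root x) -> exists dist, distance_to dist.
Proof.
move=> root_conn.
have path_ex x :
    exists n, [exists p : n.-tuple V, path H root p && (last root p == x)].
  have /connectP[p rp ->] := root_conn x.
  by exists (size p); apply/existsP; exists (in_tuple p); rewrite rp eqxx.
pose dist x := ex_minn (path_ex x).
have dist_le p : path H root p -> dist (last root p) <= size p.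
  move=> rp; rewrite /dist; case: ex_minnP => n _; apply.
  by apply/existsP; exists (in_tuple p); rewrite rp eqxx.
have geodesic x :
    exists p, [/\ path H root p, last root p = x & size p = dist x].
  rewrite /dist; case: ex_minnP => n /existsP[p /andP[rp /eqP px]] _.
  by exists p; rewrite size_tuple.
exists dist; split=> [x xr|x z xz]; have [p [rp px p_size]] := geodesic x.
  case/lastP: p => [|p z] in rp px p_size; first by rewrite -px eqxx in xr.
  move: rp px p_size.
  rewrite rcons_path last_rcons size_rcons => /andP[rp pz] <- <-.
  by exists (last root p); rewrite 1?H_sym // ltnS dist_le.
have := dist_le (rcons p z).
rewrite last_rcons size_rcons rcons_path rp px xz p_size.
exact.
Qed.

Lemma descent_connect (P : {pred V}) (dist : V -> nat) :
  (forall x, x \in P -> x != root ->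
    exists z, [/\ H x z, z \in P & dist z < dist x]) ->
  {in P &, forall x y, connect H x y}.
Proof.
move=> descent; suff to_root x : x \in P -> connect H x root.
  move=> x y xP yP.
  by rewrite (connect_trans (to_root x xP)) // (sym_connect_sym H_sym) to_root.
have [n] := ubnP (dist x); elim: n x => // n IHn x xn xP.
have [->|xr] := eqVneq x root; first exact: connect0.
have [z [xz zP zx]] := descent x xP xr.
by apply: connect_trans (connect1 xz) (IHn z _ zP); apply: leq_trans zx xn.
Qed.

End Distance.

Section ConnectedRegular.
Variables (V : finType) (e : rel V).
Hypotheses (e_sym : symmetric e) (e_irr : irreflexive e).

Definition linked (R : {set V}) :=
  independent e R && [forall x in R, forall y in R, connect (crossing e R) x y].

Definition maximum_linked R := linked R /\ forall Q, linked Q -> #|Q| <= #|R|.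

Lemma linked_at (R : {set V}) h : independent e R ->
  (forall x, x \in R -> connect (crossing e R) x h) -> linked R.
Proof.
move=> R_ind R_h; rewrite /linked R_ind; apply/forall_inP => x xR.
apply/forall_inP => y yR.
apply: connect_trans (R_h x xR) _.
by rewrite (sym_connect_sym (crossing_sym e_sym R)) R_h.
Qed.

Lemma exists_maximum_linked (x : V) :
  exists2 R, maximum_linked R & exists r, r \in R.
Proof.
have x_linked : linked [set x].
  apply: (linked_at (h := x)) => [|y /set1P->]; last exact: connect0.
  by apply/independentP => u v /set1P-> /set1P->; rewrite e_irr.
have [R R_linked R_max] := arg_maxnP (fun R : {set V} => #|R|) x_linked.
exists R => //; apply/card_gt0P.
by rewrite (leq_trans _ (R_max _ x_linked)) ?cards1.
Qed.

Variable R : {set V}.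
Hypothesis R_max : maximum_linked R.
Hypothesis e_conn : forall x y, connect e x y.
Variable r0 : V.
Hypothesis r0R : r0 \in R.

Lemma maximum_linked_independent : independent e R.
Proof. by case: R_max => /andP[]. Qed.

Lemma maximum_linked_adj u v : u \in R -> e u v -> v \notin R.
Proof.
move=> uR; apply: contraTN => vR.
by have /independentP := maximum_linked_independent; apply.
Qed.

Lemma maximum_linked_connect : {in R &, forall x y, connect (crossing e R) x y}.
Proof.
by move=> x y xR yR; case: R_max => /andP[_ /forall_inP/(_ x xR)/forall_inP->].
Qed.

Lemma linked_setU1 w b r : w \notin R -> {in R, forall x, ~~ e w x} ->
  r \in R -> e w b -> e b r -> linked (w |: R).
Proof.
move=> wR w_ind rR ewb ebr.
have bR : b \notin R by apply: contraL ewb => /w_ind.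
have bw : b != w by apply: contraTneq ewb => ->; rewrite e_irr.
have cross_sub : subrel (crossing e R) (crossing e (w |: R)).
  move=> x y /andP[exy xy]; rewrite /crossing exy /= !inE.
  have [xw|_] := eqVneq x w; last have [yw|//] := eqVneq y w.
    move: xy; rewrite {1}xw (negbTE wR).
    by case: (boolP (y \in R)) => // /w_ind; rewrite -xw exy.
  move: xy; rewrite {1}yw (negbTE wR); case: (boolP (x \in R)) => // /w_ind.
  by rewrite -yw e_sym exy.
apply: (linked_at (h := r)) => [|x].
  apply/independentP => x y; rewrite !inE => /orP[/eqP->|xR] /orP[/eqP->|yR].
  - by rewrite e_irr.
  - exact: w_ind.
  - by rewrite e_sym w_ind.
  by apply: contraTN yR; apply: maximum_linked_adj.
rewrite !inE => /orP[/eqP->|xR].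
  apply: (@connect_trans _ _ b); apply: connect1; rewrite /crossing !inE.
    by rewrite ewb eqxx (negbTE bw) (negbTE bR).
  by rewrite ebr rR (negbTE bw) (negbTE bR) orbT.
apply: connect_sub (maximum_linked_connect xR rR) => u v /cross_sub.
exact: connect1.
Qed.

Lemma maximum_linked_dominating v : v \notin R -> exists2 r, r \in R & e v r.
Proof.
pose D := [set u | (u \in R) || [exists r in R, e u r]].
suff vD : v \in D by move: vD; rewrite inE => /orP[->//|/exists_inP].
have D_closed : closed e (mem D).
  apply: (intro_closed (sym_connect_sym e_sym)) => b w ebw bD.
  apply: contraT => wD.
  have [wR w_ind] : w \notin R /\ {in R, forall x, ~~ e w x}.
    by move: wD; rewrite inE negb_or => /andP[-> /exists_inPn].
  move: bD; rewrite inE => /orP[bR|/exists_inP[r rR ebr]].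
    by have := w_ind b bR; rewrite e_sym ebw.
  case: R_max => _ /(_ (w |: R)); rewrite cardsU1 wR ltnn => -> //.
  by apply: (linked_setU1 (b := b)) rR _ ebr; rewrite // e_sym.
by rewrite -(closed_connect D_closed (e_conn r0 v)) inE r0R.
Qed.

Lemma crossing_connect x y : connect (crossing e R) x y.
Proof.
have cross_sym := sym_connect_sym (crossing_sym e_sym R).
suff to_r0 z : connect (crossing e R) z r0.
  by rewrite (connect_trans (to_r0 x)) // cross_sym.
have [zR|zR] := boolP (z \in R); first exact: maximum_linked_connect.
have [r rR ezr] := maximum_linked_dominating zR.
apply: connect_trans (maximum_linked_connect rR r0R); apply: connect1.
by rewrite crossing_notin // ezr.
Qed.

Definition roots (b : V) : {set V} := neighbours e b :&: R.

Definition private (r : V) : {set V} := [set b | roots b == [set r]].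

Definition private_star (r : V) : {set V} := r |: private r.

Lemma private_adj r b : b \in private r -> r \in R /\ e b r.
Proof.
rewrite inE => /eqP b_roots; have : r \in roots b by rewrite b_roots set11.
by rewrite !inE => /andP[].
Qed.

Lemma private_root r b x : b \in private r -> x \in R -> e b x -> x = r.
Proof.
rewrite inE => /eqP b_roots xR ebx; apply/set1P; rewrite -b_roots !inE ebx.
exact: xR.
Qed.

Lemma private_notin r b : b \in private r -> b \notin R.
Proof.
by case/private_adj=> rR ebr; apply: (maximum_linked_adj rR); rewrite e_sym.
Qed.

Lemma root_notin_private r x : x \in R -> x \notin private r.
Proof. by apply: contraL; apply: private_notin. Qed.

Lemma exists_other_root r b : b \notin R -> b \notin private r ->
  exists2 x, x \in R & (x != r) && e b x.
Proof.
move=> bR; have [y yR eby] := maximum_linked_dominating bR.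
have yb : y \in roots b by rewrite !inE eby.
rewrite inE eqEsubset negb_and => /orP[|r_sub].
  by case/subsetPn=> x; rewrite !inE => /andP[ebx xR] xr; exists x; rewrite ?xr.
exists y => //; rewrite eby andbT; apply: contraNneq r_sub => <-.
by rewrite sub1set.
Qed.

Definition removable (X : {set V}) :=
  {in ~: X &, forall x y, connect (delete (crossing e R) X) x y}.

Variable d : nat.
Hypotheses (e_reg : regular e d) (d_large : 50 <= d).

Section PrivateNeighbours.
Variables (r p q : V).
Hypotheses (pP : p \in private r) (qP : q \in private r).

Lemma private_escape x :
  x \notin private_star r -> exists2 b, e p b & b \notin private_star r.
Proof.
move=> x_star.
have [/subsetPn[b]|] := boolP (~~ (neighbours e p \subset private_star r)).
  by rewrite inE; exists b.
rewrite negbK => p_sub; exfalso.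
have p_star_card : #|p |: neighbours e p| <= #|private_star r|.
  by rewrite subset_leq_card // subUset sub1set p_sub in_setU1 pP orbT.
have star_card : #|private_star r| <= #|private r|.+1.
  by rewrite cardsU1; case: (r \notin _).
have private_all : private r = neighbours e r.
  apply/eqP; rewrite eqEcard e_reg -(e_reg p); apply/andP; split.
    by apply/subsetP => u /private_adj[_]; rewrite inE e_sym.
  by rewrite -ltnS (leq_trans _ star_card) // (leq_trans _ p_star_card) //
    cardsU1 inE e_irr.
have star_closed : closed (crossing e R) (mem (private_star r)).
  apply: (intro_closed (sym_connect_sym (crossing_sym e_sym R))) => u v uv.
  rewrite /= !in_setU1 => /orP[/eqP ur|uP].
    by move: uv; rewrite ur private_all inE => /andP[-> _]; rewrite orbT.
  move: uv; rewrite crossing_notin ?(private_notin uP) // => /andP[euv vR].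
  by rewrite (private_root uP vR euv) eqxx.
case/negP: x_star; rewrite -(closed_connect star_closed (crossing_connect r x)).
exact: setU11.
Qed.

Lemma swap_independent : ~~ e p q -> independent e (p |: (q |: (R :\ r))).
Proof.
move=> pq.
have private_ind z x : z \in private r -> x \in R -> x != r -> ~~ e z x.
  move=> zP xR; apply: contraNN => ezx; apply/eqP.
  by apply: private_root zP xR ezx.
apply/independentP => x y; rewrite !inE.
move=> /or3P[/eqP->|/eqP->|/andP[xr xR]] /or3P[/eqP->|/eqP->|/andP[yr yR]];
  rewrite ?e_irr //; try exact: private_ind;
    try by rewrite e_sym // private_ind.
by apply: contraTN yR; apply: maximum_linked_adj.
Qed.

(* Otherwise [r] could be exchanged for [p] and [q]. *)
Lemma private_clique : removable (private_star r) -> p != q -> e p q.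
Proof.
move=> star_removable pq; apply: contraT => npq; set Q := p |: (q |: (R :\ r)).
have [[rR epr] [_ eqr]] := (private_adj pP, private_adj qP).
have [pR qR] := (private_notin pP, private_notin qP).
have rp : r != p by apply: contraNneq pR => <-.
have rq : r != q by apply: contraNneq qR => <-.
have rQ : r \notin Q by rewrite !inE eqxx (negbTE rp) (negbTE rq).
have QE w : w \notin private_star r -> (w \in Q) = (w \in R).
  rewrite in_setU1 negb_or => /andP[wr wP]; rewrite !inE wr.
  have /negbTE-> : w != p by apply: contraNneq wP => ->.
  by have /negbTE-> : w != q by apply: contraNneq wP => ->.
suff Q_linked : linked Q.
  case: R_max => _ /(_ Q Q_linked).
  rewrite !cardsU1 !inE (negbTE pq) (negbTE pR) (negbTE qR).
  by rewrite !andbF (cardsD1 r R) rR ltnn.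
apply: (linked_at (h := p)) => [|x]; first exact: swap_independent.
have cross_p b : b \notin Q -> e b p -> connect (crossing e Q) b p.
  by move=> bQ ebp; apply: connect1; rewrite crossing_notin // ebp setU11.
rewrite !inE => /or3P[/eqP->|/eqP->|/andP[xr xR]]; first exact: connect0.
  apply: (@connect_trans _ _ r); last by rewrite cross_p // e_sym.
  by rewrite connect1 // crossing_in ?eqr // !inE eqxx orbT.
have x_star : x \notin private_star r.
  by rewrite in_setU1 negb_or xr root_notin_private.
have [b epb b_star] := private_escape x_star.
have bR : b \notin R.
  by apply: contra b_star => bR; rewrite (private_root pP bR epb) setU11.
have [_ b_private] : b != r /\ b \notin private r.
  by apply/andP; rewrite -negb_or -in_setU1.
have [y yR /andP[yr eby]] := exists_other_root bR b_private.
have y_star : y \notin private_star r.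
  by rewrite in_setU1 negb_or yr root_notin_private.
apply: (@connect_trans _ _ y).
  have := star_removable x y; rewrite !in_setC x_star y_star => /(_ isT isT).
  apply: connect_sub => u v /and3P[/andP[euv uv] u_star v_star].
  by apply: connect1; rewrite /crossing euv !QE.
apply: (@connect_trans _ _ b); last by rewrite cross_p ?QE // e_sym.
by rewrite connect1 // crossing_in ?QE // e_sym eby.
Qed.

End PrivateNeighbours.

Section Farthest.
Variables (dist : V -> nat) (b : V).
Hypothesis dist_r0 : distance_to (crossing e R) r0 dist.
Hypotheses (bR : b \notin R) (b_far : forall x, x \notin R -> dist x <= dist b).

Lemma farthest_removable : removable [set b].
Proof.
have [closer _] := dist_r0.
have cross_sym := delete_sym (crossing_sym e_sym R) [set b].
apply: (@descent_connect _ _ r0 cross_sym _ dist) => x.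
rewrite !inE => xb xr0; have [z xz zx] := closer x xr0.
suff [w xw /andP[wb wx]] :
    exists2 w, crossing e R x w & (w != b) && (dist w < dist x).
  by exists w; rewrite /delete xw !inE xb wb.
have [zb|zb] := eqVneq z b; last by exists z; rewrite ?zb.
have xR : x \in R.
  by move: xz; rewrite zb crossing_sym // crossing_notin // => /andP[].
have /subsetPn[w] : ~~ (neighbours e x \subset [set b]).
  apply: contraL d_large => /subset_leq_card; rewrite e_reg cards1.
  by case: d => [|[]].
rewrite !inE => exw wb; have wR := maximum_linked_adj xR exw.
by exists w; rewrite ?crossing_in ?exw // wb (leq_ltn_trans (b_far wR)) // -zb.
Qed.

Lemma private_star_removable r : b \in private r ->
  (forall x, x \notin R -> dist x = dist b -> #|roots x| = 1) ->
  removable (private_star r).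
Proof.
move=> bP far_roots; have [closer dist_lip] := dist_r0.
have [rR ebr] := private_adj bP.
have b_dist : dist b = (dist r).+1.
  have [|z bz zb] := closer b; first by apply: contraNneq bR => ->.
  move: (bz); rewrite crossing_notin // => /andP[ebz zR].
  move: zb (dist_lip z b).
  rewrite (private_root bP zR ebz) crossing_in // e_sym ebr bR.
  by move=> rb /(_ isT) br; apply/eqP; rewrite eqn_leq br.
have cross_sym := delete_sym (crossing_sym e_sym R) (private_star r).
apply: (@descent_connect _ _ r0 cross_sym _ dist) => x.
rewrite inE => x_star xr0; have [z xz zx] := closer x xr0.
suff z_star : z \notin private_star r.
  by exists z; rewrite /delete xz x_star in_setC.
apply: contra x_star; rewrite !in_setU1 => /orP[/eqP zr|zP].
  move: xz; rewrite zr crossing_sym // crossing_in // e_sym => /andP[exr xR].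
  have /cards1P[y x_roots] : #|roots x| == 1.
    by rewrite far_roots //; apply/eqP; rewrite eqn_leq b_far // b_dist -zr.
  have : r \in roots x by rewrite !inE exr.
  by rewrite x_roots => /set1P rE; rewrite inE x_roots rE eqxx orbT.
move: xz.
rewrite crossing_sym // crossing_notin ?(private_notin zP) // => /andP[ezx xR].
by rewrite (private_root zP xR ezx) eqxx.
Qed.

End Farthest.

(** * Connected regular graphs *)

Lemma colourable_even : ~~ odd #|~: R| -> colourable e.
Proof.
move=> R_even; have [s s_colours] := assembly e_sym e_irr R.
have cross_conn : {in [set: V] &, forall x y, connect (crossing e R) x y}.
  by move=> x y _ _; apply: crossing_connect.
have [j j_join] :=
  connected_join (crossing_sym e_sym R) (crossing_irr e_irr R) cross_conn
    (subsetT _) R_even.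
apply: (s_colours j (fun _ _ => 0%R)) => [|//|u v uR vR].
  by apply: eq_parity_join j_join => u; rewrite /= inE odd_degreeE big1 ?addbF.
by have /independentP/(_ u v uR vR)/negbTE-> := maximum_linked_independent.
Qed.

Section OddComplement.
Local Open Scope ring_scope.
Variable b : V.
Hypotheses (bR : b \notin R) (b_removable : removable [set b])
  (R_odd : odd #|~: R|).
Implicit Types (s : V -> bool) (j : rel V) (Y I : {set V}).

Lemma exists_admissible Y I :
  Y \subset neighbours e b :\: R -> I \subset roots b ->
  ~~ odd (#|Y| + #|I|) -> exists j, admissible e R b Y I j.
Proof.
move=> YP IP YI_even; pose B := ~: R :\ b.
have YB : Y \subset B.
  apply/subsetP => y /(subsetP YP); rewrite !inE => /andP[-> eby].
  rewrite andbT.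
  by apply: contraTneq eby => ->; rewrite e_irr.
have IR : I \subset R := subset_trans IP (subsetIr _ _).
have B_even : ~~ odd #|B| by move: R_odd; rewrite (cardsD1 b) inE bR.
have BY_I_disjoint : [disjoint B :\: Y & I].
  rewrite disjoints_subset; apply/subsetP => v; rewrite !inE => /and3P[_ _].
  by apply: contra; apply: (subsetP IR).
have join_even : ~~ odd #|(B :\: Y) :|: I|.
  rewrite cardsU (disjoint_setI0 BY_I_disjoint) cards0 subn0 cardsD
    (setIidPr YB).
  by move: YI_even; rewrite !oddD oddB ?subset_leq_card // (negbTE B_even).
have join_sub : (B :\: Y) :|: I \subset ~: [set b].
  apply/subsetP => v; rewrite !inE => /orP[/and3P[]//|/(subsetP IR) vR].
  by apply: contraNneq bR => <-.
have [j j_join] := connected_join (delete_sym (crossing_sym e_sym R) _)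
  (delete_irr (crossing_irr e_irr R) _) b_removable join_sub join_even.
exists j; split=> //; apply: eq_parity_join j_join => v.
by rewrite /= !inE andbC -andbA.
Qed.

Lemma separable_all_roots s Y : (1 < #|roots b|)%N ->
  Y \subset neighbours e b :\: R -> ~~ odd (#|Y| + #|roots b|) ->
  separable e R b s.
Proof.
move=> roots_gt1 YP Y_even.
have [j j_adm] := exists_admissible YP (subxx _) Y_even.
have [M MI M_sep] :=
  exists_signs (side_sum s j) (\sum_(y in Y) (-1) ^+ s y) roots_gt1.
exists Y, (roots b), M, j; split=> //; split=> // r r_root.
by rewrite r_root; apply: M_sep.
Qed.

(* One root [r] is left out; the signs are chosen so that [b] also avoids the
   sum at [r]. *)
Lemma separable_all_but_one_root s : (40 < #|roots b|)%N -> odd #|roots b| ->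
  separable e R b s.
Proof.
move=> roots_gt40 roots_odd.
have /card_gt0P[r rb] : (0 < #|roots b|)%N by apply: leq_trans roots_gt40.
have roots_card : #|roots b| = (#|roots b :\ r|).+1 by rewrite (cardsD1 r) rb.
rewrite roots_card in roots_odd roots_gt40.
have [||j j_adm] := @exists_admissible set0 (roots b :\ r) (sub0set _).
- exact: subD1set.
- by rewrite cards0.
have [M [MI M_r M_sep]] :=
  exists_signs_neq (side_sum s j) 0 (side_sum s j r) roots_gt40.
exists set0, (roots b :\ r), M, j; split=> //; split=> // x xb.
rewrite big_set0.
have [->|xr] := eqVneq x r; first by rewrite setD11 addr0 => /esym.
have xI : x \in roots b :\ r by rewrite in_setD1 xr.
by rewrite xI; apply: M_sep.
Qed.

Lemma separable_roots s : (1 < #|roots b|)%N -> separable e R b s.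
Proof.
move=> roots_gt1.
have [roots_odd|roots_even] := boolP (odd #|roots b|); last first.
  by apply: (@separable_all_roots _ set0); rewrite ?sub0set ?cards0.
have [nbrsR|[y yb]] := set_0Vmem (neighbours e b :\: R).
  have roots_card : #|roots b| = d.
    by rewrite -(e_reg b) /roots (setIidPl _) // -setD_eq0 nbrsR.
  by apply: separable_all_but_one_root;
    rewrite // roots_card (leq_trans _ d_large).
apply: (@separable_all_roots _ [set y]); rewrite // ?sub1set //.
by rewrite cards1 /= negbK.
Qed.

Section PrivateRoot.
Variable r : V.
Hypotheses (bP : b \in private r) (star_removable : removable (private_star r)).

Lemma separating_root s Y j : side_sum s j r <> \sum_(y in Y) (-1) ^+ s y ->
  separating e R b s Y set0 set0 j.
Proof.
move: bP; rewrite inE => /eqP b_roots r_sep; split=> // x.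
rewrite -/(roots b) b_roots.
by move=> /set1P->; rewrite inE cards0 double0 mulr0n subr0 !addr0.
Qed.

Lemma private_edge j v : admissible e R b set0 set0 j ->
  v \in private r -> v != b -> j r v.
Proof.
case=> _ _ _ [j_sym j_sub j_odd] vP vb; have vR := private_notin vP.
have : odd_degree j v by rewrite j_odd vb vR !inE.
rewrite odd_degreeE (bigD1 r) //= big1 ?addbF 1?j_sym // => w wr.
apply: contraNF wr => /j_sub/and3P[+ _ _].
rewrite crossing_notin // => /andP[evw wR].
by apply/eqP; apply: private_root vP wR evw.
Qed.

Lemma root_notin_pair y z : e r y -> e r z -> r \notin [set y; z].
Proof.
move=> ry rz; apply: (notin_neighbours e_irr).
by rewrite subUset !sub1set !inE ry.
Qed.

Lemma root_pair_join y z : e r y -> e r z -> y != b -> z != b -> y != z ->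
  parity_join (delete (crossing e R) [set b]) (mem [set y; z])
    (star r [set y; z]).
Proof.
move=> ry rz yb zb yz; have r_yz := root_notin_pair ry rz.
have yz_adj v : v \in [set y; z] -> delete (crossing e R) [set b] r v.
  have [rR _] := private_adj bP; have rb : r != b by apply: contraNneq bR => <-.
  by move=> /set2P[]->;
    rewrite /delete crossing_in // (maximum_linked_adj rR) // !inE ?ry ?rz rb.
have := star_join (delete_sym (crossing_sym e_sym R) _) r_yz yz_adj.
apply: eq_parity_join => u; rewrite cards2 yz /=.
by have [->|//] := eqVneq u r; rewrite (negbTE r_yz).
Qed.

(* The edges from [r] to two private neighbours on the same side are replaced by
   those from [b]. *)
Lemma separable_many_private s j :
  admissible e R b set0 set0 j -> side_sum s j r = 0 ->
  (3 < #|private r|)%N ->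
  separable e R b s.
Proof.
move=> j_adm r0_sum private_gt3.
have [|y [z [yA zA yz syz]]] := @pigeonhole _ _ s (private r :\ b).
  by rewrite card_bool; move: private_gt3; rewrite (cardsD1 b) bP.
move: yA zA; rewrite !in_setD1 => /andP[yb yP] /andP[zb zP].
have private_nbr v : v \in private r -> e r v.
  by case/private_adj=> _; rewrite e_sym.
have yz_sub : [set y; z] \subset neighbours e b :\: R.
  rewrite subUset !sub1set !inE !(private_notin yP) (private_notin zP) /=.
  by rewrite !(private_clique bP) // eq_sym.
have star_P := root_pair_join (private_nbr y yP) (private_nbr z zP) yb zb yz.
exists [set y; z], set0, set0, (xor_rel j (star r [set y; z])); split.
  case: (j_adm) => _ _ _ j_join; split; rewrite ?sub0set ?cards2 ?yz ?cards0 //.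
  apply: eq_parity_join (xor_join j_join star_P) => v; rewrite /= !inE orbF.
  have [->|_] := eqVneq v y; first by rewrite yb (private_notin yP).
  have [->|_] := eqVneq v z; first by rewrite zb (private_notin zP).
  by rewrite addbF orbF !andbT.
apply: separating_root; rewrite (@side_sum_toggle _ _ _ _ _ y z) //.
- rewrite r0_sum (private_edge j_adm) // big_setU1 ?inE //= big_set1 -syz.
  by case: (s y).
- by rewrite neighbours_star ?eqxx ?root_notin_pair // private_nbr.
by rewrite !(private_edge j_adm).
Qed.

Lemma root_cycle_join y z :
  e r y -> e r z -> y \notin private r -> z \notin private r -> y != z ->
  exists2 cycle, parity_join (delete (crossing e R) [set b]) xpred0 cycle &
    neighbours cycle r = [set y; z].
Proof.
move=> ry rz yP zP yz.
have off_star v : e r v -> v \notin private r ->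
    v \in ~: private_star r /\ v != b.
  move=> rv vP; rewrite in_setC in_setU1 negb_or vP andbT; split.
    by apply: contraTneq rv => ->; rewrite e_irr.
  by apply: contraNneq vP => ->.
have [[y_star yb] [z_star zb]] := (off_star y ry yP, off_star z rz zP).
have [i i_join] := path_join (delete_sym (crossing_sym e_sym R) _)
  (delete_irr (crossing_irr e_irr R) _) (star_removable y_star z_star).
exists (xor_rel i (star r [set y; z])).
  have delete_sub :
      subrel (delete (crossing e R) (private_star r))
             (delete (crossing e R) [set b]).
    have b_star v : v \notin private_star r -> v \notin [set b].
      by rewrite inE; apply: contraNneq => ->; rewrite in_setU1 bP orbT.
    by move=> u v /and3P[uv /b_star ub /b_star vb]; apply/and3P.
  have := xor_join (parity_join_sub delete_sub i_join)
    (root_pair_join ry rz yb zb yz).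
  apply: eq_parity_join => v; rewrite /= !inE.
  by have [->|_] := eqVneq v y; rewrite ?(negbTE yz) // addFb orFb addbb.
transitivity (neighbours (star r [set y; z]) r); last first.
  by rewrite neighbours_star ?eqxx // root_notin_pair.
case: i_join => _ i_sub _; apply/setP => v; rewrite !inE /xor_rel.
by have /negbTE-> : ~~ i r v by apply/negP => /i_sub/and3P[_]; rewrite setU11.
Qed.

Lemma separable_few_private s j :
  admissible e R b set0 set0 j -> side_sum s j r = 0 ->
  (#|private r| <= 3)%N ->
  separable e R b s.
Proof.
move=> j_adm r0_sum private_le3.
have [|y [z [yA zA yz [syz jyz]]]] :=
    @pigeonhole _ _ (fun v => (s v, j r v)) (neighbours e r :\: private r).
  rewrite card_prod !card_bool cardsD e_reg ltn_subRL.
  apply: (@leq_ltn_trans (3 + 4)); last exact: leq_trans d_large.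
  by rewrite leq_add2r (leq_trans (subset_leq_card (subsetIr _ _))).
move: yA zA; rewrite !in_setD => /andP[yP]; rewrite inE => ry /andP[zP].
rewrite inE => rz.
have [cycle cycle_join cycle_nbrs] := root_cycle_join ry rz yP zP yz.
exists set0, set0, set0, (xor_rel j cycle); split.
  case: j_adm => YP IP YI_even j_join; split=> //.
  by apply: eq_parity_join (xor_join j_join cycle_join) => v; rewrite addbF.
apply: separating_root; rewrite (side_sum_toggle cycle_nbrs) // r0_sum big_set0.
by case: (_ (+) _).
Qed.

Lemma separable_private s : separable e R b s.
Proof.
have [|j j_adm] := @exists_admissible set0 set0 (sub0set _) (sub0set _);
  first by rewrite cards0.
have [r0_sum|/eqP r_sum] := eqVneq (side_sum s j r) 0; last first.
  exists set0, set0, set0, j; split=> //; apply: separating_root.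
  by rewrite big_set0.
have [private_le3|] := leqP #|private r| 3;
  last exact: (separable_many_private j_adm r0_sum).
exact: separable_few_private j_adm r0_sum private_le3.
Qed.

End PrivateRoot.
End OddComplement.

Lemma colourable_odd : odd #|~: R| -> colourable e.
Proof.
move=> R_odd.
have [dist dist_r0] :=
  exists_distance (crossing_sym e_sym R) (crossing_connect r0).
have /card_gt0P[x] : 0 < #|~: R| by case: #|_| R_odd.
rewrite inE => xR.
have [far farR far_max] := @arg_maxnP _ x (fun v => v \notin R) dist xR.
have [/exists_inP[b bR /andP[/eqP b_dist roots_gt1]]|no_roots] :=
    boolP [exists (b | b \notin R), (dist b == dist far) && (1 < #|roots b|)].
  apply: (exceptional_assembly e_sym e_irr maximum_linked_independent bR) => s.
  apply: separable_roots => //.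
  apply: (farthest_removable dist_r0 bR) => z zR; rewrite b_dist.
  by apply: far_max.
have far_roots z : z \notin R -> dist z = dist far -> #|roots z| = 1.
  move=> zR z_dist; apply/eqP; rewrite eqn_leq card_gt0; apply/andP; split.
    by move: no_roots => /exists_inPn/(_ z zR); rewrite z_dist eqxx -leqNgt.
  have [r rR ezr] := maximum_linked_dominating zR.
  by apply/set0Pn; exists r; rewrite !inE ezr.
have /eqP/cards1P[r far_root] := far_roots far farR erefl.
have far_private : far \in private r by rewrite inE far_root.
apply: (exceptional_assembly e_sym e_irr maximum_linked_independent farR) => s.
have star_removable :=
  private_star_removable dist_r0 farR far_max far_private far_roots.
have far_removable := farthest_removable dist_r0 farR far_max.
exact: (separable_private farR far_removable R_odd far_private star_removable).
Qed.

End ConnectedRegular.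

Lemma connected_colourable (V : finType) (e : rel V) (d : nat) :
  symmetric e -> irreflexive e -> regular e d -> 50 <= d ->
  (forall x y, connect e x y) ->
  colourable e.
Proof.
move=> e_sym e_irr e_reg d_large e_conn.
have [x _|V0] := pickP (@predT V); last first.
  by exists (fun _ _ => 0%R) => // u; have := V0 u.
have [R R_max [r rR]] := exists_maximum_linked e_sym e_irr x.
have [R_odd|R_even] := boolP (odd #|~: R|).
  exact: (colourable_odd e_sym e_irr R_max e_conn rR e_reg d_large R_odd).
exact: (colourable_even e_sym e_irr R_max e_conn rR R_even).
Qed.

(** * From connected graphs to regular graphs *)

Section Components.
Local Open Scope ring_scope.
Variables (V : finType) (e : rel V) (d : nat).
Hypotheses (e_sym : symmetric e) (e_irr : irreflexive e) (e_reg : regular e d).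

Section Subtype.
Variable P : pred V.
Implicit Types (a : {v | P v} -> {v | P v} -> int) (u : {v | P v}).

Definition extend a (x y : V) : int :=
  if insub x is Some u then if insub y is Some v then a u v else 0 else 0.

Lemma extend_val a u v : extend a (val u) (val v) = a u v.
Proof. by rewrite /extend !valK. Qed.

Lemma row_sum_extend a u : row_sum (extend a) (val u) = row_sum a u.
Proof.
rewrite /row_sum (bigID P) /= [X in _ + X]big1 ?addr0 => [|y yP]; last first.
  by rewrite /extend valK insubN.
rewrite (reindex_omap (val : {v | P v} -> V) insub) => [|y yP] /=;
  last by rewrite insubT.
by apply: eq_big => [v|v _]; rewrite ?extend_val // valK eqxx (valP v).
Qed.

Lemma extend_offset a :
  offset_weighting (relpre val e) a -> offset_weighting e (extend a).
Proof.
rewrite /extend => -[a_sym a0 a1]; split=> x y.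
- by case: insub => [u|]; case: insub.
- move=> xy; case: insubP => // u _ uE; case: insubP => // v _ vE.
  by rewrite a0 //= uE vE.
by case: insub => // u; case: insub => // v; rewrite a1.
Qed.

Lemma regular_subtype : (forall x y, e x y -> P x -> P y) ->
  regular (relpre val e : rel {v | P v}) d.
Proof.
move=> P_closed u; rewrite -(e_reg (val u)) -(card_imset _ val_inj).
apply: eq_card => y; rewrite [RHS]inE; apply/imsetP/idP => [[v]|uy].
  by rewrite inE => uv ->.
by exists (Sub y (P_closed _ _ uy (valP u))); rewrite ?inE /= ?SubK.
Qed.

End Subtype.

Lemma component_connected (x : V) (u v : {y | connect e x y}) :
  connect (relpre val e) u v.
Proof.
have /connectP[p] : connect e (val u) (val v).
  apply: connect_trans (valP v); rewrite (sym_connect_sym e_sym).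
  by apply: valP.
elim: p u => [|z p IHp] u /= => [_ /val_inj-> //|/andP[uz zp] vE].
have xz : connect e x z := connect_trans (valP u) (connect1 uz).
by apply: (@connect_trans _ _ (Sub z xz)); [apply: connect1 | apply: IHp].
Qed.

Lemma component_colourable (x : V) : (50 <= d)%N ->
  exists2 a, offset_weighting e a &
    forall u v, connect e x u -> e u v -> row_sum a u <> row_sum a v.
Proof.
move=> d_large; pose f : rel {y | connect e x y} := relpre val e.
have f_sym : symmetric f by move=> u v; apply: e_sym.
have f_irr : irreflexive f by move=> u; apply: e_irr.
have f_reg : regular f d.
  by apply: regular_subtype => u v uv xu; apply: connect_trans xu (connect1 uv).
have [a a_offset a_sep] :=
  connected_colourable f_sym f_irr f_reg d_large (@component_connected x).
exists (extend a) => [|u v xu uv]; first exact: extend_offset.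
have xv := connect_trans xu (connect1 uv).
have := a_sep (Sub u xu) (Sub v xv) uv; rewrite -!row_sum_extend !SubK.
exact.
Qed.

Lemma regular_colourable : (50 <= d)%N -> colourable e.
Proof.
move=> d_large; have /fin_all_exists2[a a_offset a_sep] x :=
  component_colourable x d_large.
have rootE u v : e u v -> fingraph.root e u = fingraph.root e v.
  move=> uv; apply/eqP; rewrite root_connect ?connect1 //.
  by apply: sym_connect_sym.
have a_off x u v : ~~ e u v -> a x u v = 0.
  by case: (a_offset x) => _ + _; apply.
exists (fun u v => a (fingraph.root e u) u v) => [|u v uv].
  split=> u v; [|exact: a_off|by case: (a_offset (fingraph.root e u))].
  have [uv|uv] := boolP (e u v); last by rewrite !a_off // e_sym.
  by rewrite (rootE u v) //; case: (a_offset (fingraph.root e v)).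
have := a_sep (fingraph.root e u) u v; rewrite /row_sum (rootE u v) //.
apply=> //.
by rewrite (sym_connect_sym e_sym) -(rootE u v) // connect_root.
Qed.

Lemma exists_edge_function (f : V -> V -> nat) : (forall u v, f u v = f v u) ->
  exists w : {set V} -> nat, forall u v, e u v -> w [set u; v] = f u v.
Proof.
move=> f_sym; pose w (E : {set V}) :=
  if [pick p : V * V | E == [set p.1; p.2]] is Some p then f p.1 p.2 else 0%N.
exists w => u v euv.
have uv : u != v by apply: contraTneq euv => ->; rewrite e_irr.
rewrite /w; case: pickP => [[x y] /= /eqP xyE|/(_ (u, v))];
  last by rewrite eqxx.
have : u \in [set x; y] by rewrite -xyE set21.
have : v \in [set x; y] by rewrite -xyE set22.
by case/set2P=> vE /set2P[] uE; rewrite uE vE ?eqxx // in uv *.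
Qed.

Lemma weighting_of_colourable : colourable e ->
  exists w : {set V} -> nat, edge_weighting e 3 w /\ vertex_colouring e w.
Proof.
case=> a [a_sym a0 a1] a_sep.
have [|w wE] := @exists_edge_function (fun u v => absz (2 + a u v)%R).
  by move=> u v; rewrite a_sym.
exists w; split=> [_ /imsetP[[u v] + ->]|u v euv wuv].
  by rewrite inE /= => euv; rewrite wE //; have := a1 u v; lia.
have wsumE x : (wsum e w x)%:R = d.*2%:R + row_sum a x.
  have -> : d.*2%:R = \sum_(y in neighbours e x) 2 :> int.
    by rewrite sumr_const e_reg; lia.
  have -> : row_sum a x = \sum_(y in neighbours e x) a x y.
    rewrite [RHS]big_mkcond; apply: eq_bigr => y _; rewrite inE.
    by case: ifP => // /negbT/a0.
  rewrite /wsum natr_sum -big_split; apply: eq_bigr => y; rewrite inE => exy.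
  by rewrite wE 1?e_sym //= (a_sym y x); have := a1 x y; lia.
by apply: (a_sep u v euv); apply: (addrI d.*2%:R); rewrite -!wsumE wuv.
Qed.

End Components.

Theorem theorem3 (d : nat) (hd : 10 ^ 8 <= d)
    (V : finType) (e : rel V)
    (e_sym : symmetric e) (e_irr : irreflexive e)
    (e_reg : regular e d) :
  exists w : {set V} -> nat, edge_weighting e 3 w /\ vertex_colouring e w.
Proof.
have d_large : 50 <= d.
  by apply: leq_trans hd; apply: leq_trans (@leq_pexp2l 10 2 8 _ _).
apply: (weighting_of_colourable e_sym e_irr e_reg).
exact: (regular_colourable e_sym e_irr e_reg d_large).
Qed.
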